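(* For every $n\in\mathbb{N}\setminus\bigcup_{a\in\mathbb{N}}[R(3,a),R(3,a)+14]$ we have $$\mathrm{gap}(n)=\mathrm{gap}_2(n)=\lceil n/2\rceil-\alpha(n).$$ Moreover, for every $n\in\mathbb{N}$, $$\lceil n/2\rceil-\alpha(n)\le \mathrm{gap}(n)\le \lceil n/2\rceil-\alpha(n)+3.$$
   Context: All graphs are finite, simple and undirected. $\alpha(G)$ denotes the maximum size of a stable set, $\theta(G)$ the minimum number of cliques partitioning $V(G)$, and $\mathrm{gap}(G)=\theta(G)-\alpha(G)$. $\mathrm{gap}(n)$ (resp. $\mathrm{gap}_2(n)$) is the maximum of $\mathrm{gap}(G)$ over all graphs (resp. all triangle-free graphs) $G$ on $n$ vertices. $R(3,m)$ is the Ramsey number: the smallest $N$ such that every graph on $N$ vertices contains a triangle or a stable set of size $m$. $\alpha(n)$ is the minimum of $\alpha(G)$ over triangle-free graphs on $n$ vertices; equivalently $R(3,\alpha(n))\le n<R(3,\alpha(n)+1)$. *)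

(* Defs.v *)
From HB Require Import structures.
From mathcomp Require Import all_boot all_order all_algebra.
From mathcomp Require Import zify.

Set Implicit Arguments.
Unset Strict Implicit.
Unset Printing Implicit Defensive.

Definition simple_edges (T : finType) (E : {set T * T}) : bool :=
  [forall x, (x, x) \notin E] &&
  [forall x, forall y, ((x, y) \in E) == ((y, x) \in E)].

Record graph (T : finType) := Graph {
  edges : {set T * T};
  edgesP : simple_edges edges
}.

HB.instance Definition _ (T : finType) := [isSub for @edges T].
HB.instance Definition _ (T : finType) := [Finite of graph T by <:].

Lemma bigminn_le (I : finType) (p : pred I) (F : I -> nat) m i :
  p i -> \big[minn/m]_(j | p j) F j <= F i.
Proof.
move=> pi; elim: (index_enum I) (mem_index_enum i) => // j s IHs.
rewrite inE big_cons => /orP[/eqP <-|/IHs les]; first by rewrite pi geq_minl.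
by case: ifP => // _; rewrite geq_min les orbT.
Qed.

Section GraphParameters.

Variables (T : finType) (G : graph T).
Implicit Types (S : {set T}) (P : {set {set T}}).

Definition adj (x y : T) : bool := (x, y) \in edges G.

Definition stable S : bool := [forall x in S, forall y in S, ~~ adj x y].

Definition clique S : bool :=
  [forall x in S, forall y in S, (x != y) ==> adj x y].

Definition has_triangle : bool :=
  [exists x, exists y, exists z, [&& adj x y, adj y z & adj x z]].

Definition triangle_free : bool := ~~ has_triangle.

Definition clique_partition P : bool :=
  partition P [set: T] && [forall S in P, clique S].

Definition stability_number : nat := \max_(S : {set T} | stable S) #|S|.

(* The default value #|T| of the minimum is attained by the partition into
   singletons, see [clique_cover_numberP]. *)
Definition clique_cover_number : nat :=
  \big[minn/#|T|]_(P : {set {set T}} | clique_partition P) #|P|.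

(* The truncated subtraction is harmless: see [stability_le_clique_cover]. *)
Definition gap : nat := clique_cover_number - stability_number.

Lemma adj_sym x y : adj x y = adj y x.
Proof. by case/andP: (edgesP G) => _ /forallP/(_ x)/forallP/(_ y)/eqP. Qed.

Lemma adj_irr x : adj x x = false.
Proof. by case/andP: (edgesP G) => /forallP/(_ x)/negPf. Qed.

Lemma stableP S :
  reflect {in S &, forall x y, adj x y = false} (stable S).
Proof.
apply: (iffP forall_inP) => [H x y xS yS|H x xS].
  by apply/negbTE/(forall_inP (H x xS)).
by apply/forall_inP => y yS; rewrite H.
Qed.

Lemma clique_partition_singletons :
  clique_partition [set [set x] | x in [set: T]].
Proof.
apply/andP; split; last first.
  apply/forall_inP => _ /imsetP[x _ ->]; apply/forall_inP => y /set1P ->.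
  by apply/forall_inP => z /set1P ->; rewrite eqxx.
apply/and3P; split.
- apply/eqP/setP => x; rewrite inE; apply/bigcupP.
  by exists [set x]; rewrite ?set11 ?imset_f.
- apply/trivIsetP => _ _ /imsetP[x _ ->] /imsetP[y _ ->] nxy.
  rewrite disjoints1 inE; apply: contra nxy => /eqP ->; exact: eqxx.
- by apply/imsetP => -[x _ /setP/(_ x)]; rewrite !inE eqxx.
Qed.

Lemma clique_cover_numberP :
  (exists2 P, clique_partition P & #|P| = clique_cover_number) /\
  (forall P, clique_partition P -> clique_cover_number <= #|P|).
Proof.
split; last by move=> P; apply: bigminn_le.
rewrite /clique_cover_number; elim/big_ind: _ => [|m n Hm Hn|P cP].
- exists [set [set x] | x in [set: T]]; first exact: clique_partition_singletons.
  by rewrite card_imset ?cardsT //; apply: set1_inj.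
- by rewrite /minn; case: ifP.
- by exists P.
Qed.

Lemma stability_le_clique_cover : stability_number <= clique_cover_number.
Proof.
have [[P /andP[pP /forall_inP cP] <-] _] := clique_cover_numberP.
apply/bigmax_leqP => S /stableP sS.
have /and3P[/eqP covP tP _] := pP.
have inP x : x \in cover P by rewrite covP inE.
rewrite -(@card_in_imset _ _ (pblock P)); last first.
  move=> x y xS yS Exy; apply/eqP/idPn => nxy.
  have := forall_inP (cP _ (pblock_mem (inP x))) x.
  rewrite mem_pblock inP => /(_ isT)/forall_inP/(_ y).
  by rewrite Exy mem_pblock inP nxy sS // => /(_ isT).
apply/subset_leq_card/subsetP => _ /imsetP[x _ ->].
exact: pblock_mem.
Qed.

Lemma ramsey3_square m (A : {set T}) :
  triangle_free -> m ^ 2 <= #|A| ->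
  exists S : {set T}, [/\ stable S, S \subset A & #|S| = m].
Proof.
move=> tf; elim: m A => [|m IHm] A hA.
  exists set0; rewrite sub0set cards0; split=> //.
  by apply/stableP => x y; rewrite inE.
have [x xA] : exists x, x \in A by apply/card_gt0P; nia.
pose N := [set y in A | adj x y].
have sN : stable N.
  apply/stableP => y z; rewrite !inE => /andP[_ xy] /andP[_ xz].
  apply: contraNF tf => yz.
  by apply/existsP; exists x; apply/existsP; exists y; apply/existsP; exists z;
    rewrite xy yz xz.
have [ltN|leN] := ltnP m #|N|.
  have [S] : exists S, S \in [set S : {set T} | S \subset N & #|S| == m.+1].
    by apply/card_gt0P; rewrite cards_draws bin_gt0.
  rewrite inE => /andP[sSN /eqP cS]; exists S; split=> //.
    apply/stableP => y z yS zS.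
    by apply: (stableP _ sN); apply: (subsetP sSN).
  by apply: subset_trans sSN _; apply/subsetP => y; rewrite inE => /andP[].
have sNA : N \subset A :\ x.
  apply/subsetP => y; rewrite !inE => /andP[-> xy]; rewrite andbT.
  by apply: contraTneq xy => ->; rewrite adj_irr.
have [|S [sS sSB cS]] := IHm ((A :\ x) :\: N).
  have := cardsD (A :\ x) N; rewrite (setIidPr sNA).
  by have := cardsD1 x A; rewrite xA; nia.
have SP y : y \in S -> [/\ y != x, y \in A & ~~ adj x y].
  move/(subsetP sSB); rewrite !inE => /andP[nN /andP[-> yA]].
  by move: nN; rewrite yA.
exists (x |: S); split.
- apply/stableP => y z /setU1P[->|yS] /setU1P[->|zS].
  + exact: adj_irr.
  + by case/SP: zS => _ _ /negbTE.
  + by rewrite adj_sym; case/SP: yS => _ _ /negbTE.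
  + exact: (stableP _ sS).
- by apply/subsetP => y /setU1P[->//|/SP[]].
- by rewrite cardsU1 cS; case: (boolP (x \in S)) => // /SP[]; rewrite eqxx.
Qed.

End GraphParameters.

Definition max_gap (n : nat) : nat := \max_(G : graph 'I_n) gap G.

Definition max_gap2 (n : nat) : nat :=
  \max_(G : graph 'I_n | triangle_free G) gap G.

(* The default value n of the minimum is attained by the edgeless graph, see
   [min_alphaP]. *)
Definition min_alpha (n : nat) : nat :=
  \big[minn/n]_(G : graph 'I_n | triangle_free G) stability_number G.

Definition ramsey3_prop (m N : nat) : bool :=
  [forall G : graph 'I_N,
     has_triangle G || [exists S : {set 'I_N}, stable G S && (#|S| == m)]].

Lemma ramsey3_exists m : exists N, ramsey3_prop m N.
Proof.
exists (m ^ 2); apply/forallP => G.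
case: (boolP (has_triangle G)) => //= tf.
have [|S [sS _ cS]] := @ramsey3_square _ G m [set: _] tf.
  by rewrite cardsT card_ord.
by apply/existsP; exists S; rewrite sS cS eqxx.
Qed.

Definition ramsey3 (m : nat) : nat := ex_minn (ramsey3_exists m).

Lemma edgeless_subproof (T : finType) : simple_edges (set0 : {set T * T}).
Proof.
apply/andP; split; apply/forallP => x; rewrite ?inE //.
by apply/forallP => y; rewrite !inE.
Qed.

Lemma min_alphaP n :
  (exists2 G : graph 'I_n, triangle_free G & stability_number G = min_alpha n) /\
  (forall G : graph 'I_n, triangle_free G -> min_alpha n <= stability_number G).
Proof.
split; last by move=> G; apply: bigminn_le.
rewrite /min_alpha; elim/big_ind: _ => [|m p Hm Hp|G tG].
- pose G := Graph (edgeless_subproof 'I_n); exists G.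
    apply/existsP => -[x /existsP[y /existsP[z /and3P[]]]].
    by rewrite /adj inE.
  apply/eqP; rewrite eqn_leq; apply/andP; split.
    by apply/bigmax_leqP => S _; rewrite -[leqRHS]card_ord max_card.
  rewrite -[leqLHS]card_ord -cardsT; apply: leq_bigmax_cond.
  by apply/stableP => x y _ _; rewrite /adj inE.
- by rewrite /minn; case: ifP.
- by exists G.
Qed.

(* Main.v *)
Require Import Defs.
From mathcomp Require Import all_boot all_order all_algebra.
From mathcomp Require Import zify.

Set Implicit Arguments.
Unset Strict Implicit.
Unset Printing Implicit Defensive.

(** Write [P(n, t)] for the existence of a triangle-free graph on [n] vertices
    without stable sets of size [t + 1], that is, [min_alpha n <= t].

    Upper bound on the gap of [G]: remove vertex-disjoint triangles, [k] of them,
    until a triangle-free graph [H] remains. Each triangle lowers the gap by at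
    most one. In [H] cliques are edges and vertices, so by Gallai's lemma on
    matchings [H] may be replaced by disjoint factor-critical pieces with [n_i]
    (odd) vertices and stability number [a_i], each of gap
    [(n_i + 1) / 2 - a_i].

    Lower bounds on Ramsey numbers: [P(n, a)] and [P(m, b)] imply
    [P(n + m + min a b, a + b)], while deleting a closed neighbourhood shows that
    [P(n, a + 1)] implies [P(n - a - 2, a)]. Together they merge two pieces at the
    cost of two vertices, saving one unit of stability number. Starting from
    an edge and seven circulant graphs they give [P(6 x - 18, x)] for all [x], and
    hence [P(N + 6 j - 12, m + j)] whenever [P(N, m)] and [m >= 2]: a triangle is
    three vertices, and it has to be paid with half a unit of stability number.
    The bound follows for [n - 15] instead of [n] vertices, and for [n] vertices
    with three more units of stability number. *)

(** * Triangle-free graphs with small stable sets *)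

Lemma triangle_freeP (T : finType) (G : graph T) :
  reflect (forall x y z, adj G x y -> adj G y z -> adj G x z -> False)
          (triangle_free G).
Proof.
apply: (iffP negP) => [tf x y z xy yz xz | tf].
  apply: tf; apply/existsP; exists x; apply/existsP; exists y.
  by apply/existsP; exists z; apply/and3P.
move=> /existsP[x /existsP[y /existsP[z /and3P[xy yz xz]]]].
exact: tf xy yz xz.
Qed.

Lemma simple_edges_rel (T : finType) (e : rel T) :
  symmetric e -> irreflexive e -> simple_edges [set p | e p.1 p.2].
Proof.
move=> es ei; apply/andP; split; apply/forallP => x; rewrite ?inE /= ?ei //.
by apply/forallP => y; rewrite !inE /= es.
Qed.

Definition graph_of_rel (T : finType) (e : rel T) es ei : graph T :=
  Graph (@simple_edges_rel T e es ei).

Lemma adj_graph_of_rel (T : finType) (e : rel T) es ei :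
  adj (@graph_of_rel T e es ei) =2 e.
Proof. by move=> x y; rewrite /adj inE. Qed.

Lemma stable_sub (T : finType) (G : graph T) (A B : {set T}) :
  A \subset B -> stable G B -> stable G A.
Proof.
by move=> /subsetP sAB /stableP sB; apply/stableP => x y xA yA; apply: sB; apply: sAB.
Qed.

(** The vertex type is arbitrary, so that sums and subtypes serve directly as vertex sets;
    [ramsey_graph_ord] returns to ordinals. *)
Definition ramsey_graph (n t : nat) : Prop :=
  exists (T : finType) (G : graph T),
    [/\ triangle_free G, #|T| = n & forall S, stable G S -> #|S| <= t].

Lemma ramsey_graph_inj (T T' : finType) (G : graph T) (f : T' -> T) t :
  injective f ->
  (forall x y z, adj G (f x) (f y) -> adj G (f y) (f z) ->
     adj G (f x) (f z) -> False) ->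
  (forall S, stable G S -> S \subset codom f -> #|S| <= t) ->
  exists G' : graph T',
    triangle_free G' /\ forall S, stable G' S -> #|S| <= t.
Proof.
move=> fI tf bS.
have es : symmetric (fun x y => adj G (f x) (f y)) by move=> x y; rewrite adj_sym.
have ei : irreflexive (fun x y => adj G (f x) (f y)) by move=> x; rewrite adj_irr.
exists (graph_of_rel es ei); split.
  by apply/triangle_freeP => x y z; rewrite !adj_graph_of_rel; apply: tf.
move=> S /stableP sS; rewrite -(card_imset _ fI); apply: bS.
  apply/stableP => _ _ /imsetP[x xS ->] /imsetP[y yS ->].
  by have := sS x y xS yS; rewrite adj_graph_of_rel.
by apply/subsetP => _ /imsetP[x xS ->]; apply: codom_f.
Qed.

Lemma ramsey_graph_set (T : finType) (G : graph T) (A : {set T}) t :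
  {in A & &, forall x y z, adj G x y -> adj G y z -> adj G x z -> False} ->
  (forall S, stable G S -> S \subset A -> #|S| <= t) -> ramsey_graph #|A| t.
Proof.
move=> tf bS.
have [||G' [tG' bG']] := @ramsey_graph_inj T {x | x \in A} G val t val_inj.
- by move=> x y z; apply: tf; apply: valP.
- move=> S sS /subsetP sSA; apply: bS => //.
  by apply/subsetP => x /sSA/codomP[[y yA] ->].
by exists _, G'; split=> //; rewrite card_sig; apply: eq_card => x; rewrite inE.
Qed.

Lemma ramsey_graph_mono n n' t t' :
  n' <= n -> t <= t' -> ramsey_graph n t -> ramsey_graph n' t'.
Proof.
move=> le_n le_t [T [G [/triangle_freeP tf cT bS]]].
have [A cA] : exists A : {set T}, #|A| = n'.
  have [A] : exists A, A \in [set A : {set T} | A \subset [set: T] & #|A| == n'].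
    by apply/card_gt0P; rewrite cards_draws bin_gt0 cardsT cT.
  by rewrite inE => /andP[_ /eqP cA]; exists A.
rewrite -cA; apply: (@ramsey_graph_set T G) => [x y z _ _ _|S sS _]; first exact: tf.
exact: leq_trans (bS S sS) le_t.
Qed.

Lemma ramsey_graph_ord n t : ramsey_graph n t ->
  exists G : graph 'I_n, triangle_free G /\ forall S, stable G S -> #|S| <= t.
Proof.
case=> T [G [/triangle_freeP tf cT bS]].
pose f (i : 'I_n) : T := enum_val (cast_ord (esym cT) i).
apply: (@ramsey_graph_inj T 'I_n G f).
- by move=> i j /enum_val_inj/cast_ord_inj.
- by move=> x y z; apply: tf.
- by move=> S sS _; apply: bS.
Qed.

Lemma min_alpha_ramsey_graph n t : ramsey_graph n t -> min_alpha n <= t.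
Proof.
case/ramsey_graph_ord => G [tG bS]; have [_ /(_ G tG) le] := min_alphaP n.
by apply: leq_trans le _; apply/bigmax_leqP.
Qed.

Lemma ramsey_graph_edgeless n : ramsey_graph n n.
Proof.
exists 'I_n, (Graph (edgeless_subproof 'I_n)); split; rewrite ?card_ord //.
  by apply/triangle_freeP => x y z; rewrite /adj inE.
by move=> S _; rewrite -[leqRHS]card_ord max_card.
Qed.

(** * Joining two graphs along stable families *)

Section Join.

(* The vertices [inr i] are copies of [v i] and of [w i] at the same time:
   adding [v i] and [w i] to a stable set that contains [inr i] keeps its two
   sides stable, and [v i], [w i] are never both present. *)
Variables (T1 T2 : finType) (G1 : graph T1) (G2 : graph T2) (k : nat).
Variables (v : 'I_k -> T1) (w : 'I_k -> T2).
Hypotheses (vI : injective v) (wI : injective w).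
Hypothesis vS : forall i j, adj G1 (v i) (v j) = false.
Hypothesis wS : forall i j, adj G2 (w i) (w j) = false.
Hypotheses (tf1 : triangle_free G1) (tf2 : triangle_free G2).

Let cross x y := [exists i, (x == v i) && (y == w i)].

Definition join_rel (x y : T1 + T2 + 'I_k) : bool :=
  match x, y with
  | inl (inl x), inl (inl y) => adj G1 x y
  | inl (inr x), inl (inr y) => adj G2 x y
  | inl (inl x), inl (inr y) => cross x y
  | inl (inr x), inl (inl y) => cross y x
  | inl (inl x), inr i => adj G1 (v i) x
  | inr i, inl (inl x) => adj G1 (v i) x
  | inl (inr x), inr i => adj G2 (w i) x
  | inr i, inl (inr x) => adj G2 (w i) x
  | inr _, inr _ => false
  end.

Lemma join_rel_sym : symmetric join_rel.
Proof. by move=> [[x|x]|x] [[y|y]|y] //=; rewrite adj_sym. Qed.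

Lemma join_rel_irr : irreflexive join_rel.
Proof. by move=> [[x|x]|x] //=; rewrite adj_irr. Qed.

Definition join_graph := graph_of_rel join_rel_sym join_rel_irr.

(** A cross edge joins some [v i] to [w i], so a triangle containing one would need an edge inside
    one of the stable families. A triangle without cross edges lies on one side and has at most one
    copy; replacing it by its original gives a triangle of [G1] or [G2]. *)
Lemma join_triangle_free : triangle_free join_graph.
Proof.
have c1 x y z : adj G1 x y -> cross x z -> cross y z -> False.
  move=> xy /existsP[i /andP[/eqP xi _]] /existsP[j /andP[/eqP yj _]].
  by rewrite xi yj vS in xy.
have c2 x y z : adj G2 x y -> cross z x -> cross z y -> False.
  move=> xy /existsP[i /andP[_ /eqP xi]] /existsP[j /andP[_ /eqP yj]].
  by rewrite xi yj wS in xy.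
have c3 x y i : cross x y -> adj G1 (v i) x -> adj G2 (w i) y -> False.
  by move=> /existsP[j /andP[/eqP -> /eqP ->]]; rewrite vS.
have t1 x y z : adj G1 x y -> adj G1 y z -> adj G1 x z -> False.
  exact/triangle_freeP.
have t2 x y z : adj G2 x y -> adj G2 y z -> adj G2 x z -> False.
  exact/triangle_freeP.
apply/triangle_freeP => x y z; rewrite !adj_graph_of_rel.
case: x => [[x|x]|x]; case: y => [[y|y]|y]; case: z => [[z|z]|z] //= xy yz xz;
  first [ exact: t1 xy yz xz | exact: t2 xy yz xz
        | exact: c1 xy xz yz | exact: c1 xz xy yz | exact: c1 yz xy xz
        | exact: c2 xy xz yz | exact: c2 xz xy yz | exact: c2 yz xy xz
        | exact: c3 xy xz yz | exact: c3 xy yz xz | exact: c3 xz xy yz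
        | exact: c3 xz yz xy | exact: c3 yz xy xz | exact: c3 yz xz xy
        | exact: t1 xz xy yz | exact: t1 xy xz yz
        | exact: t2 xz xy yz | exact: t2 xy xz yz ].
Qed.

Lemma join_stable a b S :
  (forall S, stable G1 S -> #|S| <= a) -> (forall S, stable G2 S -> #|S| <= b) ->
  stable join_graph S -> #|S| <= a + b.
Proof.
move=> b1 b2 /stableP sS.
have {}sS x y : x \in S -> y \in S -> join_rel x y = false.
  by move=> xS yS; rewrite -(sS x y xS yS) adj_graph_of_rel.
pose S1 := [set x | inl (inl x) \in S]; pose S2 := [set x | inl (inr x) \in S].
pose I := [set i | inr i \in S].
(* Each copy in [S] is charged to a side where its original is missing. *)
pose I1 := [set i in I | v i \notin S1]; pose I2 := [set i in I | w i \notin S2].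
have cS : #|S| <= #|S1| + #|S2| + #|I|.
  apply: (@leq_trans #|[set inl (inl x) | x in S1] :|:
            [set inl (inr x) | x in S2] :|: [set inr i | i in I]|).
    apply/subset_leq_card/subsetP => -[[x|x]|x] xS; rewrite !inE.
    - by rewrite imset_f ?inE.
    - by rewrite orbC orbA imset_f ?orbT ?inE.
    - by rewrite [X in _ || X]imset_f ?orbT ?inE.
  by rewrite (leq_trans (leq_card_setU _ _)) // leq_add ?leq_imset_card //
     (leq_trans (leq_card_setU _ _)) // leq_add ?leq_imset_card.
have cI : #|I| <= #|I1| + #|I2|.
  apply: leq_trans (leq_card_setU I1 I2).
  apply/subset_leq_card/subsetP => i iI; rewrite !inE in iI *; rewrite iI /=.
  rewrite -negb_and; apply/negP => /andP[vi wi].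
  have := sS _ _ vi wi; suff -> : join_rel (inl (inl (v i))) (inl (inr (w i))) by [].
  by apply/existsP; exists i; rewrite !eqxx.
have c1 : #|S1| + #|I1| <= a.
  rewrite -(card_imset _ vI) -cardsUI.
  have -> : S1 :&: [set v x | x in I1] = set0.
    apply/setP => x; rewrite !inE; apply/negP => /andP[xS /imsetP[i]].
    by rewrite !inE => /andP[_ vi] xi; rewrite xi (negPf vi) in xS.
  have P x : x \in S1 :|: [set v x | x in I1] ->
      inl (inl x) \in S \/ exists2 i, inr i \in S & x = v i.
    case/setUP => [|/imsetP[i]]; rewrite !inE; first by left.
    by case/andP => iS _ ->; right; exists i.
  rewrite cards0 addn0; apply: b1; apply/stableP => x y.
  move=> /P[xS|[i iS ->]] /P[yS|[j jS ->]].
  - exact: sS xS yS.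
  - by rewrite adj_sym; apply: sS jS xS.
  - exact: sS iS yS.
  - exact: vS.
have c2 : #|S2| + #|I2| <= b.
  rewrite -(card_imset _ wI) -cardsUI.
  have -> : S2 :&: [set w x | x in I2] = set0.
    apply/setP => x; rewrite !inE; apply/negP => /andP[xS /imsetP[i]].
    by rewrite !inE => /andP[_ vi] xi; rewrite xi (negPf vi) in xS.
  have P x : x \in S2 :|: [set w x | x in I2] ->
      inl (inr x) \in S \/ exists2 i, inr i \in S & x = w i.
    case/setUP => [|/imsetP[i]]; rewrite !inE; first by left.
    by case/andP => iS _ ->; right; exists i.
  rewrite cards0 addn0; apply: b2; apply/stableP => x y.
  move=> /P[xS|[i iS ->]] /P[yS|[j jS ->]].
  - exact: sS xS yS.
  - by rewrite adj_sym; apply: sS jS xS.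
  - exact: sS iS yS.
  - exact: wS.
lia.
Qed.

Lemma ramsey_graph_join_stable a b :
  (forall S, stable G1 S -> #|S| <= a) -> (forall S, stable G2 S -> #|S| <= b) ->
  ramsey_graph (#|T1| + #|T2| + k) (a + b).
Proof.
move=> b1 b2; exists (T1 + T2 + 'I_k)%type, join_graph; split.
- exact: join_triangle_free.
- by rewrite !card_sum card_ord.
- by move=> S; apply: join_stable.
Qed.

End Join.

Lemma stable_family (T : finType) (G : graph T) (S : {set T}) k :
  stable G S -> k <= #|S| ->
  exists v : 'I_k -> T, injective v /\ forall i j, adj G (v i) (v j) = false.
Proof.
move=> /stableP sS le; exists (fun i => enum_val (widen_ord le i)); split.
  by move=> i j /enum_val_inj/(congr1 val)/= ij; apply: val_inj.
by move=> i j; apply: sS; apply: enum_valP.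
Qed.

Lemma ramsey_graph_disjoint n m a b :
  ramsey_graph n a -> ramsey_graph m b -> ramsey_graph (n + m) (a + b).
Proof.
case=> [T1 [G1 [tf1 <- b1]]] [T2 [G2 [tf2 <- b2]]].
have [[v [vI vS]] [w [wI wS]]] :
    (exists v : 'I_0 -> T1, injective v /\ forall i j, adj G1 (v i) (v j) = false) /\
    (exists w : 'I_0 -> T2, injective w /\ forall i j, adj G2 (w i) (w j) = false).
  have s0 (T : finType) (G : graph T) : stable G set0.
    by apply/stableP => x y; rewrite inE.
  by split; apply: stable_family (s0 _ _) _.
rewrite -[_ + #|T2|]addn0.
exact: (ramsey_graph_join_stable vI wI vS wS tf1 tf2 b1 b2).
Qed.

Lemma ramsey_graph_tight n a : ramsey_graph n a ->
  exists (T : finType) (G : graph T) (S : {set T}),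
    [/\ triangle_free G, #|T| = n, stable G S, #|S| <= a
      & forall S', stable G S' -> #|S'| <= #|S|].
Proof.
case=> T [G [tf cT bS]].
have s0 : stable G set0 by apply/stableP => x y; rewrite inE.
case: (@arg_maxnP _ set0 (stable G) (fun S : {set T} => #|S|) s0) => S sS mS.
by exists T, G, S; split=> //; apply: bS.
Qed.

Lemma ramsey_graph_join n m a b :
  ramsey_graph n a -> ramsey_graph m b ->
  ramsey_graph (n + m + minn a b) (a + b).
Proof.
case/ramsey_graph_tight => [T1 [G1 [S1 [tf1 <- s1 le1 b1]]]].
case/ramsey_graph_tight => [T2 [G2 [S2 [tf2 <- s2 le2 b2]]]].
have [v [vI vS]] := stable_family s1 (geq_minl #|S1| #|S2|).
have [w [wI wS]] := stable_family s2 (geq_minr #|S1| #|S2|).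
have J := ramsey_graph_join_stable vI wI vS wS tf1 tf2 b1 b2.
(* The join uses the actual stability numbers; isolated vertices make up for their distance to [a]
   and [b]. *)
have := ramsey_graph_disjoint J (ramsey_graph_edgeless (a - #|S1| + (b - #|S2|))).
by apply: ramsey_graph_mono; lia.
Qed.

Lemma ramsey_graph_delete n a : ramsey_graph n a.+1 -> ramsey_graph (n - a.+2) a.
Proof.
case=> T [G [tf cT bS]].
have [/card0_eq T0|/card_gt0P[x _]] := posnP #|T|.
  have -> : n - a.+2 = 0 by rewrite -cT (eq_card0 T0).
  exact: ramsey_graph_mono (leqnn 0) (leq0n a) (ramsey_graph_edgeless 0).
pose N := [set y | adj G x y].
have sN : stable G N.
  apply/stableP => y z; rewrite !inE => xy xz; apply/negP => yz.
  exact: (triangle_freeP _ tf) xy yz xz.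
pose A := ~: (x |: N).
apply: (@ramsey_graph_mono #|A| _ a) => //.
  have := cardsC (x |: N); rewrite cT cardsU1 -/A.
  by have := bS N sN; case: (x \notin N); lia.
apply: (@ramsey_graph_set T G) => [y z u _ _ _|S sS /subsetP sSA].
  by apply/triangle_freeP.
have nS y : y \in S -> (y == x) = false /\ adj G x y = false.
  by move=> /sSA; rewrite !inE negb_or => /andP[/negPf -> /negPf ->].
have := bS (x |: S); rewrite cardsU1.
have -> : x \notin S by apply/negP => /nS[]; rewrite eqxx.
rewrite add1n ltnS; apply; apply/stableP => y z.
case/setU1P => [->|yS] /setU1P[->|zS].
- exact: adj_irr.
- by case: (nS z zS).
- by rewrite adj_sym; case: (nS y yS).
- exact: (stableP _ _ sS).
Qed.

Lemma ramsey_graph0 n : ramsey_graph n 0 -> n = 0.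
Proof.
case=> T [G [tf cT bS]]; apply/eqP; rewrite -leqn0 leqNgt; apply/negP.
rewrite -cT => /card_gt0P[x _].
have := bS [set x]; rewrite cards1 ltnn => /(_ _)/notF; apply; apply/stableP => y z.
by move=> /set1P-> /set1P->; apply: adj_irr.
Qed.

(** If [a <= b], the deletion takes [a + 1] vertices from the first graph and the join gives back
    [a - 1]; lowering the larger bound would cost more. *)
Lemma ramsey_graph_merge n m a b : 0 < a -> 0 < b ->
  ramsey_graph n a -> ramsey_graph m b -> ramsey_graph (n + m - 2) (a + b).-1.
Proof.
wlog le_ab : n m a b / a <= b.
  move=> H a0 b0 Pa Pb; case/orP: (leq_total a b) => le; first exact: H.
  by rewrite addnC [a + b]addnC; apply: H.
case: a le_ab => // a le_ab _ b0 /ramsey_graph_delete Pa Pb.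
by have := ramsey_graph_join Pa Pb; apply: ramsey_graph_mono; lia.
Qed.

(** * Bounding the stable sets of circulant graphs by computation *)

(* Sets of vertices are bit masks; the entry of [ups] at [i] lists the
   adjacencies of [i] with the vertices from [i + 1] on. *)
Fixpoint meets (s u : bitseq) : bool :=
  match s, u with
  | b :: s, c :: u => b && c || meets s u
  | _, _ => false
  end.

Fixpoint mask_stable (s : bitseq) (ups : seq bitseq) : bool :=
  match s, ups with
  | b :: s, u :: ups => (b ==> ~~ meets s u) && mask_stable s ups
  | _, _ => true
  end.

(** One step of the greedy matching: the first vertex of [p] marked in [u] becomes the partner of
    the current vertex and leaves [p]. *)
Fixpoint strike (p u : bitseq) : option bitseq :=
  match p, u with
  | b :: p, c :: u =>
      if b && c then Some (false :: p)
      else if strike p u is Some q then Some (b :: q) else None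
  | _, _ => None
  end.

(* Greedy, hence incomplete; a matching bounds the stable sets of [p] from above. *)
Fixpoint matching_exceeds (need : nat) (p : bitseq) (ups : seq bitseq) : bool :=
  match p, ups with
  | b :: p, u :: ups =>
      if b then
        if strike p u is Some q then
          if need is need.+1 then matching_exceeds need q ups else true
        else matching_exceeds need p ups
      else matching_exceeds need p ups
  | _, _ => false
  end.

Fixpoint common (p r : bitseq) : nat :=
  match p, r with
  | b :: p, c :: r => if b && c then (common p r).+1 else common p r
  | _, _ => 0
  end.

Fixpoint max_degree_vertex (p0 p : bitseq) (rows : seq bitseq) (i best deg : nat) :=
  match p, rows with
  | b :: p, r :: rows =>
      if b then
        let d := common p0 r in
        if Nat.leb d deg then max_degree_vertex p0 p rows i.+1 best deg
        else max_degree_vertex p0 p rows i.+1 i d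
      else max_degree_vertex p0 p rows i.+1 best deg
  | _, _ => best
  end.

Fixpoint mask_diff (p r : bitseq) : bitseq :=
  match p, r with
  | b :: p, c :: r => (b && ~~ c) :: mask_diff p r
  | _, _ => p
  end.

Fixpoint mask_clear (p : bitseq) (i : nat) : bitseq :=
  match p, i with
  | b :: p, i.+1 => b :: mask_clear p i
  | _ :: p, 0 => false :: p
  | [::], _ => [::]
  end.

(** Branch and bound: [true] certifies that [p] contains no stable set of size [k], [false] only
    that the search was inconclusive. Among [c] vertices, a matching with more than [c - k] edges
    leaves fewer than [k] for a stable set. *)
Fixpoint no_stable (fuel : nat) (rows ups : seq bitseq) (p : bitseq) (k : nat) :=
  if fuel is fuel.+1 then
    let c := count id p in
    if c < k then true
    else if matching_exceeds (c - k) p ups then true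
    else
      let i := max_degree_vertex p p rows 0 0 0 in
      let p' := mask_clear p i in
      if k is k'.+1 then
        if no_stable fuel rows ups (mask_diff p' (nth [::] rows i)) k'
        then no_stable fuel rows ups p' k else false
      else false
  else false.

(** * Soundness of the search *)

Lemma all2_implb_nth s p : size s = size p ->
  (forall i, nth false s i -> nth false p i) -> all2 implb s p.
Proof.
elim: s p => [|b s IHs] [|c p] //= [sz] H; rewrite IHs // ?andbT.
  by apply/implyP; apply: (H 0).
by move=> i; apply: (H i.+1).
Qed.

Lemma meetsN s u : (forall i, nth false s i -> ~~ nth false u i) -> ~~ meets s u.
Proof.
elim: s u => [|b s IHs] [|c u] //= H; rewrite negb_or IHs ?andbT.
  by rewrite negb_and -implybE; apply/implyP; apply: (H 0).
by move=> i; apply: (H i.+1).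
Qed.

Lemma meets_sub s s' u : all2 implb s s' -> meets s u -> meets s' u.
Proof.
elim: s s' u => [|b s IHs] [|b' s'] [|c u] //= /andP[bb' ss'] /orP[/andP[hb hc]|/IHs H].
  by rewrite (implyP bb' hb) hc.
by rewrite H ?orbT.
Qed.

Lemma mask_stable_sub s s' ups :
  all2 implb s s' -> mask_stable s' ups -> mask_stable s ups.
Proof.
elim: s s' ups => [|b s IHs] [|b' s'] [|u ups] //= /andP[bb' ss'] /andP[mu st].
rewrite (IHs _ _ ss' st) andbT; apply/implyP => hb.
by move/implyP: mu => /(_ (implyP bb' hb)); apply: contra; apply: meets_sub.
Qed.

Lemma mask_stable_nth s ups :
  (forall i j, i < j -> nth false s i -> nth false s j ->
     ~~ nth false (nth [::] ups i) (j - i.+1)) ->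
  mask_stable s ups.
Proof.
elim: s ups => [|b s IHs] [|u ups] //= H; apply/andP; split.
  apply/implyP => hb; apply: meetsN => i si.
  by have := H 0 i.+1 isT hb si; rewrite /= subn1.
by apply: IHs => i j ij si sj; have := H i.+1 j.+1 ij si sj; rewrite /= subSS.
Qed.

(** [s'] is [s] without the struck vertex; as that vertex is marked in [u], nothing is removed when
    [s] avoids [u]. *)
Lemma strikeP p u q : strike p u = Some q ->
  count id p = (count id q).+1 /\
  forall s, all2 implb s p -> exists s',
    [/\ all2 implb s' q, all2 implb s' s, count id s <= (count id s').+1
      & ~~ meets s u -> s' = s].
Proof.
have refl s : all2 implb s s by elim: s => [|[] s IHs].
elim: p u q => [|b p IHp] [|c u] q //=.
case: ifP => [/andP[hb hc] [<-]|bc].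
  split; first by rewrite hb.
  case=> [|e s] //= /andP[_ sp]; exists (false :: s); rewrite /= sp refl /=.
  split=> //; first by case: e; rewrite /= ?leqnSn.
  by rewrite hc andbT negb_or => /andP[/negPf ->].
case E: (strike p u) => [r|] // [<-]; have [cr H] := IHp _ _ E.
split; first by rewrite /= cr addnS.
case=> [|e s] //= /andP[eb sp]; have [s' [s'r s's le eq]] := H s sp.
exists (e :: s'); rewrite /= eb s'r s's implybb; split=> //.
  by rewrite -addnS leq_add2l.
by rewrite negb_or => /andP[_ /eq ->].
Qed.

Lemma count_sub s p : all2 implb s p -> count id s <= count id p.
Proof.
elim: s p => [|b s IHs] [|c p] //= /andP[bc /IHs le].
by apply: leq_add => //; case: b c bc => [] [].
Qed.

(** A stable set omits an end of each of the [need + 1] matching edges. *)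
Lemma matching_exceedsP need p ups s :
  matching_exceeds need p ups -> all2 implb s p -> mask_stable s ups ->
  count id s + need < count id p.
Proof.
elim: ups need p s => [|u ups IH] need [|b p] [|e s] //= me /andP[eb sp] /andP[eu st].
have rest : matching_exceeds need p ups -> e + count id s + need < b + count id p.
  by move=> /IH/(_ sp st); case: e b eb {eu me} => [] [] //=; lia.
case: b eb me rest => eb me rest; last exact: rest.
case E: (strike p u) me => [q|] me; last exact: rest.
have [cq H] := strikeP E.
have [s' [s'q s's le eq]] := H s sp.
have les' : e + count id s <= (count id s').+1.
  by case: e eu {eb rest} => //= eu; rewrite (eq eu) add1n.
case: need me {rest} => [|need] me; last first.
  by have := IH _ _ _ me s'q (mask_stable_sub s's st); lia.
by have := count_sub s'q; lia.
Qed.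

Lemma size_mask_clear p i : size (mask_clear p i) = size p.
Proof. by elim: p i => [|b p IHp] [|i] //=; rewrite IHp. Qed.

Lemma nth_mask_clear p i j :
  nth false (mask_clear p i) j = nth false p j && (j != i).
Proof.
elim: p i j => [|b p IHp] [|i] [|j] //=; rewrite ?andbT ?andbF //.
by rewrite IHp eqSS.
Qed.

Lemma size_mask_diff p r : size (mask_diff p r) = size p.
Proof. by elim: p r => [|b p IHp] [|c r] //=; rewrite IHp. Qed.

Lemma nth_mask_diff p r j :
  nth false (mask_diff p r) j = nth false p j && ~~ nth false r j.
Proof.
elim: p r j => [|b p IHp] [|c r] [|j] //=; rewrite ?nth_nil ?andbT //.
Qed.

(** A stable set either contains the branching vertex, and its other members avoid the neighbours,
    or lies in the mask with that vertex cleared. *)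
Lemma no_stableP n (G : graph 'I_n) rows ups fuel p k (S : {set 'I_n}) :
  size p = n ->
  (forall i j : 'I_n, nth false (nth [::] rows i) j -> adj G i j) ->
  (forall i j : 'I_n, i < j -> nth false (nth [::] ups i) (j - i.+1) -> adj G i j) ->
  no_stable fuel rows ups p k ->
  (forall i : 'I_n, i \in S -> nth false p i) -> stable G S -> #|S| < k.
Proof.
move=> szp rowsP upsP; elim: fuel p k S szp => //= fuel IH p k S szp.
pose s := [seq x \in S | x <- enum 'I_n].
have szs : size s = size p by rewrite size_map size_enum_ord szp.
have nths (i : 'I_n) : nth false s i = (i \in S).
  by rewrite (nth_map i) ?size_enum_ord // nth_ord_enum.
have s_ord i : nth false s i -> exists2 x : 'I_n, x \in S & i = x.
  have [lt|ge] := ltnP i n; last by rewrite nth_default ?szs ?szp.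
  by rewrite -[i]/(val (Ordinal lt)) nths; exists (Ordinal lt).
have cs : count id s = #|S|.
  by rewrite count_map -size_filter cardE {1}/(enum S) -enumT.
case: ltnP => [ltc _ sub _|lekc].
  rewrite -cs; apply: leq_ltn_trans ltc; apply/count_sub/all2_implb_nth => // i.
  by case/s_ord => x xS ->; apply: sub.
case: ifP => [me _ sub st|_].
  have sp : all2 implb s p.
    by apply: all2_implb_nth => // i; case/s_ord => x xS ->; apply: sub.
  suff /(matching_exceedsP me sp) : mask_stable s ups.
    rewrite cs; move: lekc; move: (count _ p) #|S| => c a; clear; lia.
  apply: mask_stable_nth => i j ij /s_ord[x xS ix] /s_ord[y yS jy].
  apply/negP; rewrite ix jy in ij * => /(upsP _ _ ij).
  by rewrite (stableP _ _ st).
set i := max_degree_vertex _ _ _ _ _ _; case: k lekc => // k _.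
case: ifP => // H1 H2 sub st.
have [iS|niS] := boolP (nth false s i); last first.
  apply: (IH (mask_clear p i)) => //; first by rewrite size_mask_clear.
  move=> x xS; rewrite nth_mask_clear sub //=.
  by apply: contraNneq niS => <-; rewrite nths.
have [x xS ix] := s_ord _ iS.
rewrite (cardsD1 x) xS add1n ltnS; apply: (IH _ _ _ _ H1).
- by rewrite size_mask_diff size_mask_clear.
- move=> y; rewrite !inE => /andP[yx yS].
  rewrite nth_mask_diff nth_mask_clear sub //= ix yx.
  by apply/negP => /rowsP; rewrite (stableP _ _ st).
- by apply: stable_sub st; apply: subD1set.
Qed.

(* [d] is the characteristic sequence of the connection set. *)
Definition circulant_ok (d : bitseq) : bool :=
  let n := size d in
  [&& ~~ nth false d 0,
      all (fun i => nth false d ((n - i) %% n) == nth false d i) (iota 0 n)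
    & all (fun i => nth false d i ==>
        all (fun j => nth false d j ==> ~~ nth false d ((i + j) %% n)) (iota 0 n))
        (iota 0 n)].

(** The stable set is taken to contain vertex [0]: the mask holds the other non-neighbours of [0],
    and excluding [k] of them bounds the whole set by [k]. By rotation, [behead d] lists the later
    neighbours of every vertex. *)
Definition circulant_no_stable (fuel : nat) (d : bitseq) (k : nat) : bool :=
  let n := size d in
  let rows := mkseq (fun i => mkseq (fun j => nth false d ((j + (n - i)) %% n)) n) n in
  no_stable fuel rows (nseq n (behead d)) (false :: map negb (behead d)) k.

Lemma ramsey_graph_circulant fuel (d : bitseq) k :
  circulant_ok d -> circulant_no_stable fuel d k -> ramsey_graph (size d) k.
Proof.
rewrite /circulant_ok /circulant_no_stable.
(* A nonempty vertex set is ['I_n.+1], which carries addition modulo [n.+1]. *)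
case E: (size d) => [|n].
  by move=> _ _; apply: ramsey_graph_mono (leq0n _) (ramsey_graph_edgeless 0).
case/and3P => d0 /allP dN /allP dD check.
pose c (x : 'I_n.+1) := nth false d x.
have xI (x : 'I_n.+1) : val x \in iota 0 n.+1 by rewrite mem_iota ltn_ord.
have cN x : c (- x)%R = c x by apply/eqP/(dN x (xI x)).
have cD x y : c x -> c y -> ~~ c (x + y)%R.
  by move=> cx cy; have /implyP/(_ cx)/allP/(_ y (xI y))/implyP/(_ cy) := dD x (xI x).
pose e x y := c (y - x)%R.
have es : symmetric e by move=> x y; rewrite /e -cN GRing.opprB.
have ei : irreflexive e.
  by move=> x; rewrite /e GRing.subrr /c; apply/negbTE: d0.
pose G := graph_of_rel es ei.
have adjE x y : adj G x y = c (y - x)%R by rewrite adj_graph_of_rel.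
exists _, G; split; rewrite ?card_ord //.
  apply/triangle_freeP => x y z; rewrite !adjE => xy yz.
  apply/negP; have := cD _ _ yz xy.
  by rewrite GRing.addrA GRing.subrK.
move=> S st; have [->|[s sS]] := set_0Vmem S; first by rewrite cards0.
(* A rotation moves an element of [S] to [0], where the search starts. *)
pose S' := [set (x - s)%R | x in S].
have cS' : #|S'| = #|S| by apply: card_imset; apply: GRing.addIr.
have S'0 : 0%R \in S' by apply/imsetP; exists s; rewrite ?GRing.subrr.
have stS' : stable G S'.
  apply/stableP => _ _ /imsetP[x xS ->] /imsetP[y yS ->].
  by rewrite adjE GRing.opprB GRing.addrA GRing.subrK -adjE (stableP _ _ st).
rewrite -cS' (cardsD1 0%R) S'0 add1n.
apply: no_stableP check _ (stable_sub (subD1set _ _) stS').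
- by rewrite /= size_map size_behead E.
- move=> i j; rewrite nth_mkseq // nth_mkseq // adjE /c /= => H.
  by rewrite modnDmr.
- move=> i j ij; rewrite nth_nseq ltn_ord nth_behead => H.
  rewrite adjE /c /= modnDmr; move: H; congr (is_true (nth _ _ _)).
  have -> : j + (n.+1 - i) = (j - i) + n.+1.
    by have := ltn_ord i; move: ij; clear; lia.
  rewrite modnDr modn_small; first exact: subnSK.
  exact: leq_ltn_trans (leq_subr _ _) (ltn_ord j).
- move=> i; rewrite !inE => /andP[i0 iS'].
  have : adj G 0%R i = false by apply: (stableP _ _ stS').
  rewrite adjE GRing.subr0 /c; case: i i0 {iS'} => -[|i] //= lt _ /negbT.
  by rewrite (nth_map false) ?size_behead ?E // nth_behead.
Qed.

(** [D] lists the connection set up to negation modulo [n]. *)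
Definition connection_set (n : nat) (D : seq nat) : bitseq :=
  mkseq (fun i => (i \in D) || (n - i \in D)) n.

(** * A linear lower bound on the Ramsey numbers *)

(** The fuel 100 bounds the depth of the search, which branches on one vertex per level; the graphs
    below have at most 87 vertices. *)
Lemma ramsey_graph_connection_set n D k :
  circulant_ok (connection_set n D) ->
  circulant_no_stable 100 (connection_set n D) k -> ramsey_graph n k.
Proof. by move=> ok /(ramsey_graph_circulant ok); rewrite size_mkseq. Qed.

Lemma ramsey_graph_2_1 : ramsey_graph 2 1.
Proof. by apply: (@ramsey_graph_connection_set 2 [:: 1]); vm_compute. Qed.

Lemma ramsey_graph_13_4 : ramsey_graph 13 4.
Proof. by apply: (@ramsey_graph_connection_set 13 [:: 1; 5]); vm_compute. Qed.

Lemma ramsey_graph_26_7 : ramsey_graph 26 7.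
Proof. by apply: (@ramsey_graph_connection_set 26 [:: 1; 3; 8; 13]); vm_compute. Qed.

Lemma ramsey_graph_35_8 : ramsey_graph 35 8.
Proof. by apply: (@ramsey_graph_connection_set 35 [:: 1; 7; 11; 16]); vm_compute. Qed.

Lemma ramsey_graph_45_10 : ramsey_graph 45 10.
Proof.
by apply: (@ramsey_graph_connection_set 45 [:: 1; 3; 5; 12; 19]); vm_compute.
Qed.

Lemma ramsey_graph_57_12 : ramsey_graph 57 12.
Proof.
by apply: (@ramsey_graph_connection_set 57 [:: 1; 4; 6; 9; 20; 23]); vm_compute.
Qed.

Lemma ramsey_graph_72_14 : ramsey_graph 72 14.
Proof.
by apply: (@ramsey_graph_connection_set 72 [:: 1; 3; 12; 18; 23; 25; 33]);
  vm_compute.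
Qed.

Lemma ramsey_graph_87_16 : ramsey_graph 87 16.
Proof.
by apply: (@ramsey_graph_connection_set 87 [:: 1; 3; 9; 17; 21; 28; 36; 41]);
  vm_compute.
Qed.

Lemma ramsey_graph_add n m a b c t :
  ramsey_graph n a -> ramsey_graph m b ->
  c <= n + m + minn a b -> a + b = t -> ramsey_graph c t.
Proof.
by move=> Pa Pb le <-; apply: ramsey_graph_mono le (leqnn _) (ramsey_graph_join Pa Pb).
Qed.

Lemma ramsey_graph_linear x : ramsey_graph (6 * x - 18) x.
Proof.
have P1 := ramsey_graph_2_1.
(* The join of two edges is a pentagon. *)
have P2 : ramsey_graph 5 2 by apply: (ramsey_graph_add P1 P1).
have P3 : ramsey_graph 8 3 by apply: ramsey_graph_add P1 P2 _ _.
have P4 := ramsey_graph_13_4.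
have P5 : ramsey_graph 16 5 by apply: ramsey_graph_add P1 P4 _ _.
have P6 : ramsey_graph 20 6 by apply: ramsey_graph_add P2 P4 _ _.
have P7 := ramsey_graph_26_7.
have P8 := ramsey_graph_35_8.
have P10 := ramsey_graph_45_10.
have P12 := ramsey_graph_57_12.
have P14 := ramsey_graph_72_14.
have P16 := ramsey_graph_87_16.
elim/ltn_ind: x => x IH.
(* Since [87 = 6 * 16 - 9], joining with the graph on 87 vertices costs nine vertices, and the gain
   [minn 16 (x - 16)] is at least nine from [x = 25] on. *)
have [|lt_x] := ltnP x 25; last first.
  apply: ramsey_graph_add P16 (IH (x - 16) _) _ _; lia.
(* For [x <= 3] the truncated [6 * x - 18] is zero; the values 4 to 24 remain, with equality at 21
   and 23. *)
case: x {IH} => [|[|[|[|x]]]]; try by move=> _; apply: ramsey_graph_mono (ramsey_graph_edgeless 0).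
do 21?[case: x => [|x]]; move=> // _.
- by apply: ramsey_graph_mono P4.
- by apply: ramsey_graph_mono P5.
- by apply: ramsey_graph_mono P6.
- by apply: ramsey_graph_mono P7.
- by apply: ramsey_graph_mono P8.
- by apply: ramsey_graph_add P1 P8 _ _.
- by apply: ramsey_graph_mono P10.
- by apply: ramsey_graph_add P1 P10 _ _.
- by apply: ramsey_graph_mono P12.
- by apply: ramsey_graph_add P1 P12 _ _.
- by apply: ramsey_graph_mono P14.
- by apply: ramsey_graph_add P1 P14 _ _.
- by apply: ramsey_graph_mono P16.
- by apply: ramsey_graph_add P1 P16 _ _.
- by apply: ramsey_graph_add P2 P16 _ _.
- by apply: ramsey_graph_add P3 P16 _ _.
- by apply: ramsey_graph_add P4 P16 _ _.
- by apply: ramsey_graph_add P5 P16 _ _.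
- by apply: ramsey_graph_add P8 P14 _ _.
- by apply: ramsey_graph_add P7 P16 _ _.
- by apply: ramsey_graph_add P8 P16 _ _.
Qed.

(** Repeated deletion allows at most 2, 5, 9, 14, 20 vertices for the bounds 1 to 5. The form
    [6 * m - 6] makes [N + 6 * j - 12] at most [6 * (m + j) - 18]. *)
Lemma ramsey_graph_small N m : 1 < m <= 5 -> ramsey_graph N m -> N <= 6 * m - 6.
Proof.
have D n a t : ramsey_graph n a.+1 -> (ramsey_graph (n - a.+2) a -> n - a.+2 <= t) ->
    n <= t + a.+2.
  by move=> /ramsey_graph_delete P /(_ P); lia.
have B0 n : ramsey_graph n 0 -> n <= 0 by move/ramsey_graph0->.
have B1 n : ramsey_graph n 1 -> n <= 2 by move=> P; apply: (D n 0 0 P); apply: B0.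
have B2 n : ramsey_graph n 2 -> n <= 5 by move=> P; apply: (D n 1 2 P); apply: B1.
have B3 n : ramsey_graph n 3 -> n <= 9 by move=> P; apply: (D n 2 5 P); apply: B2.
have B4 n : ramsey_graph n 4 -> n <= 14 by move=> P; apply: (D n 3 9 P); apply: B3.
have B5 n : ramsey_graph n 5 -> n <= 20 by move=> P; apply: (D n 4 14 P); apply: B4.
case: m => [|[|[|[|[|[|m]]]]]] // _.
- by move/B2; lia.
- by move/B3; lia.
- by move/B4; lia.
- by move/B5; lia.
Qed.

(** For [m <= 5] the linear bound at [m + j] suffices. If [m] and [j] both exceed 5, joining with a
    graph on [6 * j - 18] vertices gains at least six more. The other values of [j] are treated one
    by one. *)
Lemma ramsey_graph_grow N m j : 1 < m ->
  ramsey_graph N m -> ramsey_graph (N + 6 * j - 12) (m + j).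
Proof.
move=> m1 P.
have P1 := ramsey_graph_2_1.
have P2 : ramsey_graph 5 2 by apply: (ramsey_graph_add P1 P1).
have P3 : ramsey_graph 8 3 by apply: ramsey_graph_add P1 P2 _ _.
have P5 : ramsey_graph 16 5 by apply: ramsey_graph_add P1 ramsey_graph_13_4 _ _.
have [m6|m5] := ltnP 5 m; last first.
  have le := ramsey_graph_small (introT andP (conj m1 m5)) P.
  by apply: ramsey_graph_mono (ramsey_graph_linear (m + j)); lia.
have [j6|] := ltnP 5 j.
  by apply: ramsey_graph_add P (ramsey_graph_linear j) _ _; lia.
case: j => [|[|[|[|[|[|j]]]]]] // _.
- by apply: ramsey_graph_mono P; lia.
- by apply: ramsey_graph_mono P; lia.
- by apply: ramsey_graph_mono P; lia.
- by apply: ramsey_graph_add P P3 _ _; lia.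
- by apply: ramsey_graph_add P ramsey_graph_13_4 _ _; lia.
- by apply: ramsey_graph_add P P5 _ _; lia.
Qed.

(** * Matchings as involutions, and Gallai's lemma *)

Section Matching.

Variables (T : finType) (G : graph T).
Implicit Types (A B H : {set T}) (f g : {ffun T -> T}).

Definition matching A f : bool :=
  [forall x, (f (f x) == x) && ((f x != x) ==> (x \in A) && adj G x (f x))].

Lemma matchingP A f :
  reflect (involutive f /\ forall x, f x != x -> x \in A /\ adj G x (f x))
          (matching A f).
Proof.
apply: (iffP forallP) => [H|[fK fA] x]; last first.
  by rewrite fK eqxx /=; apply/implyP => /fA[-> ->].
split=> x; first by have /andP[/eqP] := H x.
by have /andP[_ /implyP fx] := H x; move/fx/andP.
Qed.

Definition missed A f : {set T} := [set x in A | f x == x].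

Lemma matching_id A : matching A [ffun x => x].
Proof. by apply/matchingP; split=> x; rewrite !ffunE // eqxx. Qed.

Definition max_matching A : {ffun T -> T} :=
  [arg min_(f < [ffun x => x] | matching A f) #|missed A f|].

Definition defect A : nat := #|missed A (max_matching A)|.

Lemma max_matching_matching A : matching A (max_matching A).
Proof. by rewrite /max_matching; case: arg_minnP => //; apply: matching_id. Qed.

Lemma defect_le A f : matching A f -> defect A <= #|missed A f|.
Proof.
rewrite /defect /max_matching; case: arg_minnP => [|g _ gmin]; last exact: gmin.
exact: matching_id.
Qed.

Definition optimal A f : bool := matching A f && (#|missed A f| == defect A).

Lemma optimal_max_matching A : optimal A (max_matching A).
Proof. by rewrite /optimal max_matching_matching eqxx. Qed.

Lemma matching_sub A B f : A \subset B -> matching A f -> matching B f.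
Proof.
move=> /subsetP sAB /matchingP[fK fA]; apply/matchingP; split=> // x.
by move/fA => [/sAB].
Qed.

Lemma matching_in A f x : matching A f -> x \in A -> f x \in A.
Proof.
move=> /matchingP[fK fA] xA; have [->//|/eqP ne] := f x =P x.
by have [] : f x \in A /\ adj G (f x) (f (f x)) by apply: fA; rewrite fK eq_sym.
Qed.

(** One representative of each matching edge and each missed vertex, that is, of each clique in the
    cover given by [f]. *)
Definition reps A f : {set T} := [set x in A | enum_rank x <= enum_rank (f x)].

(** [f] exchanges the lower and the upper ends of its edges, so there are equally many of both. *)
Lemma card_reps A f : matching A f -> 2 * #|reps A f| = #|A| + #|missed A f|.
Proof.
move=> mf; have [fK _] := matchingP _ _ mf.
pose up := [set x in A | enum_rank x < enum_rank (f x)].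
pose down := [set x in A | enum_rank (f x) < enum_rank x].
have ud : #|down| = #|up|.
  rewrite -(card_imset (mem up) (inv_inj fK)); apply: eq_card => x.
  apply/idP/imsetP => [|[y yu ->]].
    by rewrite inE => /andP[xA lt]; exists (f x); rewrite ?fK // inE fK lt (matching_in mf).
  by move: yu; rewrite !inE fK => /andP[yA ->]; rewrite (matching_in mf).
have rE : #|reps A f| = #|missed A f| + #|up|.
  rewrite -cardsUI [missed A f :&: up]disjoint_setI0 ?cards0 ?addn0.
    apply: eq_card => x; rewrite !inE -andb_orr; congr (_ && _).
    by rewrite leq_eqVlt val_eqE (inj_eq enum_rank_inj) eq_sym.
  rewrite -setI_eq0; apply/eqP/setP => x; rewrite !inE; apply/negP.
  by move=> /andP[/andP[_ /eqP ->] /andP[_]]; rewrite ltnn.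
have AE : #|A| = #|reps A f| + #|down|.
  rewrite -cardsUI [reps A f :&: down]disjoint_setI0 ?cards0 ?addn0.
    by apply: eq_card => x; rewrite !inE -andb_orr leqNgt orNb andbT.
  rewrite -setI_eq0; apply/eqP/setP => x; rewrite !inE; apply/negP.
  by move=> /andP[/andP[_ le] /andP[_]]; rewrite ltnNge le.
lia.
Qed.

(** Matches [a] with [b] and leaves their former partners unmatched. *)
Definition rewire f a b : {ffun T -> T} :=
  [ffun x => if x == a then b else if x == b then a
             else if (x == f a) || (x == f b) then x else f x].

Lemma rewire_matching A f a b : matching A f ->
  a \in A -> b \in A -> adj G a b -> matching A (rewire f a b).
Proof.
move=> /matchingP[fK fA] aA bA ab.
have nab : a != b by apply: contraTneq ab => ->; rewrite adj_irr.
have fI := inv_inj fK.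
apply/matchingP; split=> x; rewrite !ffunE.
  have [->|xa] := eqVneq x a; first by rewrite eq_sym (negPf nab) eqxx.
  have [->|xb] := eqVneq x b; first by rewrite eqxx.
  have [xf|] := boolP ((x == f a) || (x == f b)).
    by rewrite (negPf xa) (negPf xb) xf.
  rewrite negb_or => /andP[xfa xfb].
  have -> : (f x == a) = false by rewrite -(inj_eq fI) fK; apply: negPf.
  have -> : (f x == b) = false by rewrite -(inj_eq fI) fK; apply: negPf.
  by rewrite !(inj_eq fI) (negPf xa) (negPf xb) /= fK.
have [->|xa] := eqVneq x a; first by [].
have [->|xb] := eqVneq x b; first by rewrite adj_sym.
by case: ifP => [_|_ /fA //]; rewrite eqxx.
Qed.

Lemma optimal_missed_nonadj A f a b : optimal A f ->
  a \in missed A f -> b \in missed A f -> adj G a b = false.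
Proof.
move=> /andP[mf /eqP df]; rewrite !inE => /andP[aA /eqP fa] /andP[bA /eqP fb].
apply/negP => ab; have := defect_le (rewire_matching mf aA bA ab).
rewrite -df leqNgt => /negP; apply; apply: proper_card; apply/properP; split.
  apply/subsetP => x; rewrite !inE ffunE fa fb.
  have [->|xa] := eqVneq x a; first by rewrite aA fa eqxx.
  have [->|xb] := eqVneq x b; first by rewrite bA fb eqxx.
  by [].
exists a; rewrite !inE ?aA ?fa ?eqxx // ffunE eqxx /=.
by apply: contraTneq ab => ->; rewrite adj_irr.
Qed.

(** Gallai's relation. Adjacent vertices of [A] are related; when every vertex of [A] is missed by
    some maximum matching, it is an equivalence on [A], without edges between different classes. *)
Definition near A a b : bool :=
  (a == b) ||
  ~~ [exists f, [&& optimal A f, a \in missed A f & b \in missed A f]].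

Lemma nearN A a b : ~~ near A a b ->
  exists f, [/\ a != b, optimal A f, a \in missed A f & b \in missed A f].
Proof.
by rewrite negb_or negbK => /andP[ab /existsP[f /and3P[]]]; exists f.
Qed.

Lemma near_missed A a b f : near A a b -> a != b ->
  optimal A f -> a \in missed A f -> b \notin missed A f.
Proof.
case/orP => [/eqP ->|/existsPn/(_ f)]; first by rewrite eqxx.
by move=> H _ of1 af; move: H; rewrite of1 af.
Qed.

(* Among the maximum matchings missing [y] take one that agrees most with a
   maximum matching missing both [x] and [z]; an exchange along a single edge
   of the latter improves the agreement. *)
Lemma near_trans A x y z :
  (exists2 g, optimal A g & y \in missed A g) ->
  near A x y -> near A y z -> near A x z.
Proof.
move=> [g0 og0 yg0] xy yz; apply/idPn => /nearN[f [nxz of1 xf zf]].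
have nxy : x != y.
  apply: contraNneq nxz => exy; rewrite -exy in yz.
  by apply/idPn => nxz; have := near_missed yz nxz of1 xf; rewrite zf.
have nyz : y != z.
  apply/eqP => eyz; rewrite eyz in xy.
  by have := near_missed xy nxz of1 xf; rewrite zf.
pose good g := optimal A g && (y \in missed A g).
pose agree g := [set v | g v == f v].
have good0 : good g0 by rewrite /good og0.
case: (@arg_maxnP _ g0 good (fun g => #|agree g|) good0) => g /andP[og yg] gmax.
have xg : x \notin missed A g.
  by apply/negP => xg; have := near_missed xy nxy og xg; rewrite yg.
have zg := near_missed yz nyz og yg.
have [mf /eqP cf] := andP of1; have [mg /eqP cg] := andP og.
(* Both matchings miss equally many vertices and [g] covers [x] and [z], so [g] misses at least two
   vertices that [f] covers, one of them other than [y]. *)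
have [w] : exists w, w \in (missed A g :\: missed A f) :\ y.
  apply/card_gt0P.
  have c2 : 1 < #|missed A f :\: missed A g|.
    apply: (@leq_trans #|[set x; z]|); first by rewrite cards2 nxz.
    by apply/subset_leq_card/subsetP => v /set2P[] ->; rewrite inE ?xg ?zg ?xf ?zf.
  have eqc : #|missed A g :\: missed A f| = #|missed A f :\: missed A g|.
    by rewrite !cardsD setIC cf cg.
  move: c2; rewrite -eqc (cardsD1 y); case: (y \in _) => //; exact: ltnW.
rewrite !inE => /and3P[wy]; have [wA|] := boolP (w \in A); last by [].
rewrite /= => fw /eqP gw.
have [fK fA] := matchingP _ _ mf; have [gK gA] := matchingP _ _ mg.
have [_ adjw] := fA w fw.
have fwA : f w \in A by apply: matching_in.
(* Otherwise the edge from [w] to [f w] would enlarge [g]. *)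
have gfw : g (f w) != f w.
  apply/negP => gfw; have := @optimal_missed_nonadj A g w (f w) og.
  by rewrite !inE wA fwA gw gfw eqxx adjw => /(_ isT isT).
have mh := rewire_matching mg wA fwA adjw; set h := rewire _ _ _ in mh.
have gy : g y = y by move: yg; rewrite inE => /andP[_ /eqP].
have yA : y \in A by move: yg; rewrite inE => /andP[].
have oh : optimal A h.
  rewrite /optimal mh /= eqn_leq defect_le // andbT.
  apply: (@leq_trans #|g (f w) |: (missed A g :\ w)|).
    apply/subset_leq_card/subsetP => v; rewrite !inE ffunE.
    have [->|vw] := eqVneq v w; first by rewrite (negPf fw) andbF.
    have [->|vfw] := eqVneq v (f w); first by rewrite eq_sym (negPf fw) andbF.
    rewrite gw (negPf vw) /=.
    by have [//|/=] := eqVneq v (g (f w)).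
  rewrite -cg (cardsD1 w (missed A g)) inE wA gw eqxx cardsU1.
  by apply: leq_add => //; case: (_ \notin _).
have yh : y \in missed A h.
  rewrite inE yA ffunE [y == w]eq_sym (negPf wy) /=.
  have -> : (y == f w) = false by apply: contraNF gfw => /eqP <-; rewrite gy.
  by rewrite gy; case: ifP.
have := gmax h; rewrite /good oh yh => /(_ isT); apply/negP; rewrite -ltnNge.
apply: proper_card; apply/properP; split; last first.
  by exists w; rewrite inE ?ffunE ?gw eq_sym ?(negPf fw) // eq_sym eqxx.
(* No agreement is lost: if [f] and [g] agreed at [g (f w)], then [g (f w) = w], although [g] fixes
   [w] and [f] does not. *)
apply/subsetP => v; rewrite !inE => gv; rewrite ffunE.
have [vw|vw] := eqVneq v w; first by rewrite vw gw eq_sym (negPf fw) in gv.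
have [vfw|vfw] := eqVneq v (f w); first by rewrite vfw fK.
have [vg|vg] := eqVneq v (g (f w)); last by rewrite gw (negPf vw).
by rewrite vg gK -vg (inj_eq (inv_inj fK)) eq_sym (negPf vw) in gv.
Qed.

Definition alpha_in A : nat := \max_(S : {set T} | stable G S && (S \subset A)) #|S|.

Lemma alpha_in_ge A (S : {set T}) : stable G S -> S \subset A -> #|S| <= alpha_in A.
Proof.
move=> sS sSA; rewrite /alpha_in.
apply: (@leq_bigmax_cond _ (fun S => stable G S && (S \subset A))
          (fun S : {set T} => #|S|)).
by rewrite sS.
Qed.

Lemma alpha_in_attained A :
  exists S, [/\ stable G S, S \subset A & #|S| = alpha_in A].
Proof.
pose P (S : {set T}) := stable G S && (S \subset A).
have P0 : P set0.
  by rewrite /P sub0set andbT; apply/stableP => x y; rewrite inE.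
case: (@arg_maxnP _ set0 P (fun S : {set T} => #|S|) P0) => S /andP[sS sSA] mS.
exists S; split=> //; apply/eqP; rewrite eqn_leq alpha_in_ge //=.
by apply/bigmax_leqP => S' /mS.
Qed.

Lemma alpha_in_sub A B : A \subset B -> alpha_in A <= alpha_in B.
Proof.
move=> sAB; have [S [sS sSA <-]] := alpha_in_attained A.
by apply: alpha_in_ge => //; apply: subset_trans sSA sAB.
Qed.

Lemma alpha_in_gt0 A x : x \in A -> 0 < alpha_in A.
Proof.
move=> xA; rewrite -(cards1 x); apply: alpha_in_ge; rewrite ?sub1set //.
by apply/stableP => y z /set1P-> /set1P->; rewrite adj_irr.
Qed.

Lemma defect_setU A B : [disjoint A & B] -> defect (A :|: B) <= defect A + defect B.
Proof.
move=> dAB; have mA := max_matching_matching A; have mB := max_matching_matching B.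
set f := max_matching A in mA *; set g := max_matching B in mB *.
have [fK fA] := matchingP _ _ mA; have [gK gB] := matchingP _ _ mB.
have gA x : x \notin A -> g x \notin A.
  move=> xA; have [->//|/gB[xB _]] := eqVneq (g x) x.
  by apply: (contraTN _ (matching_in mB xB)) => gxA; rewrite (disjointFr dAB gxA).
pose h : {ffun T -> T} := [ffun x => if x \in A then f x else g x].
have mh : matching (A :|: B) h.
  apply/matchingP; split=> x; rewrite !ffunE.
    have [xA|xA] := boolP (x \in A); first by rewrite (matching_in mA xA) fK.
    by rewrite (negPf (gA x xA)) gK.
  have [xA|xA] := boolP (x \in A); first by move/fA => [_]; rewrite inE xA.
  by move/gB => [xB]; rewrite inE xB orbT.
apply: leq_trans (defect_le mh) _; apply: leq_trans (leq_card_setU _ _).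
apply/subset_leq_card/subsetP => x; rewrite !inE ffunE.
by case: (x \in A) => //= ->.
Qed.

Lemma alpha_in_setU A B : [disjoint A & B] ->
  {in A & B, forall x y, adj G x y = false} -> alpha_in A + alpha_in B <= alpha_in (A :|: B).
Proof.
move=> dAB nAB; have [S [sS sSA <-]] := alpha_in_attained A.
have [S' [sS' sSB <-]] := alpha_in_attained B.
have d : [disjoint S & S'] by apply: disjointWl sSA _; apply: disjointWr sSB _.
rewrite -cardsUI (disjoint_setI0 d) cards0 addn0.
apply: alpha_in_ge; last exact: setUSS.
move/subsetP: sSA => sSA; move/subsetP: sSB => sSB.
apply/stableP => x y /setUP[xS|xS] /setUP[yS|yS].
- exact: (stableP _ _ sS).
- by apply: nAB; [apply: sSA | apply: sSB].
- by rewrite adj_sym; apply: nAB; [apply: sSA | apply: sSB].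
- exact: (stableP _ _ sS').
Qed.

Definition triangle_free_on A : Prop :=
  {in A & &, forall x y z, adj G x y -> adj G y z -> adj G x z -> False}.

Lemma ramsey_graph_alpha_in A : triangle_free_on A -> ramsey_graph #|A| (alpha_in A).
Proof. by move=> tf; apply: ramsey_graph_set tf _ => S; apply: alpha_in_ge. Qed.

(* By Gallai's lemma the graph splits into factor-critical pieces; [c] counts
   them, and [N], [m] are the parameters of the graph they are merged into. *)
Definition merged_components A : Prop :=
  exists N m c : nat,
    [/\ ramsey_graph N m, 1 < m, 1 < N, 0 < c
      & #|A| + defect A + 2 * m <= N + c + 2 * alpha_in A /\ N + 2 * c <= #|A| + 2].

(** In the left alternative the cover by matching edges and missed vertices has at most [alpha_in A]
    members. *)
Lemma gallai_decomposition A : triangle_free_on A ->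
  #|A| + defect A <= 2 * alpha_in A \/ merged_components A.
Proof.
move: {2}#|A|.+1 (ltnSn #|A|) => u; elim: u A => // u IH A leA tf.
have IHs B : B \proper A -> #|B| + defect B <= 2 * alpha_in B \/ merged_components B.
  move=> pBA; have lt := proper_card pBA; apply: IH; first by lia.
  by have /subsetP sBA := proper_sub pBA; move=> x y z /sBA xA /sBA yA /sBA zA; apply: tf.
have par := card_reps (max_matching_matching A); rewrite -/(defect A) in par.
(* If every maximum matching covers [v], deleting [v] raises the defect, so [#|A| + defect A] is at
   most the same sum for [A :\ v]. *)
have [/existsP[v /andP[vA /forallP nv]]|/existsPn crit] := boolP
    [exists v, (v \in A) && [forall f, optimal A f ==> (v \notin missed A f)]].
  have cA : #|A| = (#|A :\ v|).+1 by rewrite (cardsD1 v) vA.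
  have dB : defect A < defect (A :\ v).
    have mB := max_matching_matching (A :\ v); set f := max_matching _ in mB.
    have mA : matching A f := matching_sub (subD1set A v) mB.
    have fv : f v = v.
      apply/eqP/idPn => /(proj2 (matchingP _ _ mB))[].
      by rewrite !inE eqxx.
    have vf : v \in missed A f by rewrite inE vA fv eqxx.
    have cf : #|missed A f| = (defect (A :\ v)).+1.
      rewrite (cardsD1 v) vf add1n /defect -/f; congr _.+1.
      by apply: eq_card => x; rewrite !inE andbA.
    have := implyP (nv f); rewrite /optimal mA vf /= => /(_ _)/notF nopt.
    have ne : #|missed A f| != defect A by apply/eqP => e; apply: nopt; rewrite e eqxx.
    (* Both numbers have the parity of [#|A|]; being different, they differ by at least two. *)
    have := defect_le mA; have := card_reps mA; move: ne; rewrite cf.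
    by move: par; clear; lia.
  have := alpha_in_sub (subD1set A v).
  case: (IHs (A :\ v)); first by apply: properD1.
    by left; lia.
  case=> N [m [c [PN m1 N1 c0 [le1 le2]]]] le3; right.
  by exists N, m, c; split=> //; lia.
have {}crit v : v \in A -> exists2 f, optimal A f & v \in missed A f.
  move=> vA; have := crit v; rewrite vA /= => /forallPn[f].
  by rewrite negb_imply negbK => /andP[of1 vf]; exists f.
(* Every vertex is now missed by some maximum matching. With defect at most one, [A] is a single
   piece unless its stability number is at most one. *)
have [d2|d1] := ltnP 1 (defect A); last first.
  have [A0|[a aA]] := set_0Vmem A.
    by left; rewrite A0 cards0; move: d1 par; rewrite A0 cards0; lia.
  have a0 := alpha_in_gt0 aA; have PA := ramsey_graph_alpha_in tf.
  have [a1|a1] := leqP (alpha_in A) 1.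
    have {}PA : ramsey_graph #|A| 1 by apply: ramsey_graph_mono PA.
    by have := ramsey_graph0 (ramsey_graph_delete PA); left; lia.
  right; exists #|A|, (alpha_in A), 1; split=> //; last by lia.
  by have [S [_ sSA cS]] := alpha_in_attained A; have := subset_leq_card sSA; lia.
have [a [b [ab af bf]]] : exists a b,
    [/\ a != b, a \in missed A (max_matching A) & b \in missed A (max_matching A)].
  move: d2; rewrite /defect => d2.
  have [a aM] : exists a, a \in missed A (max_matching A) by apply/card_gt0P; lia.
  have [b] : exists b, b \in missed A (max_matching A) :\ a.
    by apply/card_gt0P; move: d2; rewrite (cardsD1 a) aM.
  by rewrite in_setD1 => /andP[ba bM]; exists a, b; rewrite eq_sym.
have aA : a \in A by move: af; rewrite inE => /andP[].
have bA : b \in A by move: bf; rewrite inE => /andP[].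
(* The class of [a] omits [b] and no edge leaves it, so [A] splits: defects are subadditive and
   stability numbers superadditive. *)
pose C := [set x in A | near A a x]; pose B := A :\: C.
have sCA : C \subset A by apply/subsetP => x; rewrite inE => /andP[].
have AE : A = C :|: B.
  by apply/setP => x; rewrite !inE; case: (x \in A); case: (near A a x).
have nab : ~~ near A a b.
  by apply/negP => nab; have := near_missed nab ab (optimal_max_matching A) af; rewrite bf.
have pC : C \proper A.
  by apply/properP; split=> //; exists b; rewrite ?inE ?bA.
have pB : B \proper A.
  apply/properP; split; first exact: subsetDl.
  by exists a; rewrite ?inE ?aA /near ?eqxx.
have dCB : [disjoint C & B].
  by rewrite -setI_eq0; apply/eqP/setP => x; rewrite !inE; case: (x \in A); case: (near A a x).
have nCB : {in C & B, forall x y, adj G x y = false}.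
  move=> x y; rewrite !inE => /andP[xA ax] /andP[ny yA]; rewrite yA /= in ny.
  apply/negP => xy; apply: (negP ny); apply: near_trans ax _; first exact: crit.
  apply/idPn => /nearN[f [_ of1 xf yf]].
  by rewrite (optimal_missed_nonadj of1 xf yf) in xy.
have cAE : #|A| = #|C| + #|B| by rewrite -cardsUI (disjoint_setI0 dCB) cards0 addn0 -AE.
have dA := defect_setU dCB; have aAE := alpha_in_setU dCB nCB; rewrite -AE in dA aAE.
move: (IHs C pC) (IHs B pB) cAE dA aAE; rewrite /merged_components.
move: #|A| #|B| #|C| (defect A) (defect B) (defect C).
move: (alpha_in A) (alpha_in B) (alpha_in C) => alA alB alC cA cB cC dA dB dC; clear.
move=> [lC|[N1 [m1 [c1 [P1 m1g N1g c1g [l1 l1']]]]]]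
       [lB|[N2 [m2 [c2 [P2 m2g N2g c2g [l2 l2']]]]]] cAE dAE aAE.
- by left; lia.
- by right; exists N2, m2, c2; split=> //; lia.
- by right; exists N1, m1, c1; split=> //; lia.
(* The merge loses two vertices and one unit, so [N - 2 * m] is additive. *)
- right; exists (N1 + N2 - 2), (m1 + m2).-1, (c1 + c2); split; try lia.
  by apply: ramsey_graph_merge P1 P2; lia.
Qed.

End Matching.

(** * Removing triangles *)

Section CliqueCover.

Variables (T : finType) (G : graph T).
Implicit Types (A B H : {set T}).

(** The cliques are the fibres of [r]. Values stay in [A], so that a clique split off from [A] can
    receive a value of its own. *)
Definition clique_cover A (k : nat) : Prop :=
  exists r : T -> T,
    [/\ {in A, forall x, r x \in A}, #|r @: A| <= k
      & {in A &, forall x y, r x = r y -> x = y \/ adj G x y}].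

Lemma clique_cover_number_le k : clique_cover [set: T] k -> clique_cover_number G <= k.
Proof.
case=> r [_ rk rA]; apply: leq_trans rk.
have [_ /(_ (preim_partition r [set: T])) le] := clique_cover_numberP G.
apply: leq_trans (le _) _.
  rewrite /clique_partition preim_partitionP; apply/forall_inP => S.
  case/imsetP => x _ ->; apply/forall_inP => y; rewrite !inE /= => /eqP ry.
  apply/forall_inP => z; rewrite !inE /= => /eqP rz; apply/implyP => /eqP yz.
  by have [|//|//] := rA y z (in_setT _) (in_setT _); rewrite -ry -rz.
apply: leq_trans (leq_imset_card (fun c => [set y | r y == c]) _).
apply/subset_leq_card/subsetP => _ /imsetP[x _ ->].
apply/imsetP; exists (r x); first exact: imset_f.
by apply/setP => y; rewrite !inE /= eq_sym.
Qed.

Lemma clique_cover_matching A f : matching G A f -> clique_cover A #|reps A f|.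
Proof.
move=> mf; have [fK fA] := matchingP _ _ _ mf.
exists (fun x => if x \in reps A f then x else f x); split.
- by move=> x xA; case: ifP => // _; apply: matching_in mf xA.
- apply/subset_leq_card/subsetP => _ /imsetP[x xA ->].
  case: ifP => //; rewrite !inE xA (matching_in mf xA) fK /=.
  by move/negbT; rewrite -ltnNge; apply: ltnW.
- move=> x y xA yA.
  have adjf z : z \in A -> z <> f z -> adj G z (f z).
    by move=> zA ne; apply: (proj2 (fA z _)); apply/eqP => e; apply: ne.
  case: ifP => _; case: ifP => _ exy; first by left.
  + have [eyx|/eqP ne] := eqVneq y (f y); first by left; rewrite exy -eyx.
    by right; rewrite exy adj_sym; apply: adjf.
  + have [exx|/eqP ne] := eqVneq x (f x); first by left; rewrite exx.
    by right; rewrite -exy; apply: adjf.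
  + by left; apply: inv_inj fK _ _ exy.
Qed.

Lemma clique_cover_add A B k x : x \in B -> B \subset A ->
  {in B &, forall y z, y = z \/ adj G y z} ->
  clique_cover (A :\: B) k -> clique_cover A k.+1.
Proof.
move=> xB /subsetP sBA cB [r [rA rk rP]].
have inD y : y \in A -> y \notin B -> y \in A :\: B by rewrite inE => -> ->.
exists (fun y => if y \in B then x else r y); split.
- move=> y yA; case: ifPn => [_|yB]; first exact: sBA.
  by have := rA y (inD y yA yB); rewrite inE => /andP[].
- apply: (@leq_trans #|x |: r @: (A :\: B)|); last first.
    by rewrite cardsU1 -add1n; apply: leq_add => //; case: (_ \notin _).
  apply/subset_leq_card/subsetP => _ /imsetP[y yA ->]; rewrite !inE.
  by case: ifPn => [_|yB]; rewrite ?eqxx // imset_f ?orbT // inD.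
- move=> y z yA zA; case: ifPn => yB; case: ifPn => zB.
  + by move=> _; apply: cB.
  + move=> e; have := rA z (inD z zA zB); by rewrite -e inE xB.
  + move=> e; have := rA y (inD y yA yB); by rewrite e inE xB.
  + by apply: rP; apply: inD.
Qed.

(** Triangles are removed greedily; [j] counts the edges of a maximum matching of [H] and the
    vertices it misses. *)
Lemma triangle_packing A : exists k H j,
  [/\ H \subset A, triangle_free_on G H, #|A| = 3 * k + #|H|,
      clique_cover A (k + j) & 2 * j = #|H| + defect G H].
Proof.
move: {2}#|A|.+1 (ltnSn #|A|) => u; elim: u A => // u IH A leA.
have [/existsP[x /existsP[y /existsP[z]]]|tf] := boolP [exists x, exists y, exists z,
    [&& x \in A, y \in A, z \in A, adj G x y, adj G y z & adj G x z]]; last first.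
  exists 0, A, #|reps A (max_matching G A)|; split=> //.
  - move=> x y z xA yA zA xy yz xz; move/negP: tf; apply.
    apply/existsP; exists x; apply/existsP; exists y; apply/existsP; exists z.
    by rewrite xA yA zA xy yz xz.
  - exact/clique_cover_matching/max_matching_matching.
  - exact/card_reps/max_matching_matching.
case/and5P => xA yA zA xy /andP[yz xz].
pose B := [set x; y; z].
have ne a b : adj G a b -> (a == b) = false.
  by move=> ab; apply: contraTF ab => /eqP ->; rewrite adj_irr.
have sBA : B \subset A by apply/subsetP => a; rewrite !inE => /orP[/orP[]|] /eqP->.
have cB : #|B| = 3.
  by rewrite /B -setUA !cardsU1 cards1 !inE (ne _ _ xy) (ne _ _ xz) (ne _ _ yz).
have cA : #|A| = 3 + #|A :\: B| by rewrite -cB -(cardsID B A) (setIidPr sBA).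
have [|k [H [j [sHA tf cH cov par]]]] := IH (A :\: B); first by lia.
exists k.+1, H, j; split=> //; first by apply: subset_trans sHA (subsetDl _ _).
  by rewrite cA cH; lia.
apply: clique_cover_add (_ : x \in B) sBA _ cov; first by rewrite !inE eqxx.
move=> a b; rewrite !inE => /orP[/orP[]|] /eqP-> /orP[/orP[]|] /eqP->;
  by [left | right; rewrite // adj_sym].
Qed.

Lemma stability_number_alpha_in : stability_number G = alpha_in G [set: T].
Proof. by apply: eq_bigl => S; rewrite subsetT andbT. Qed.

Lemma gap_small_stability : stability_number G <= 1 -> gap G = 0.
Proof.
move=> a1; apply/eqP; rewrite subn_eq0.
have [T0|[x _]] := set_0Vmem [set: T].
  rewrite (leq_trans (clique_cover_number_le (k := 0) _)) //.
  by exists id; split=> // [|y]; rewrite T0 ?imset0 ?cards0 // inE.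
have a0 : 0 < stability_number G.
  by rewrite stability_number_alpha_in; apply: (@alpha_in_gt0 _ _ _ x).
apply: leq_trans a0; apply: clique_cover_number_le.
exists (fun=> x); split=> // [|y z _ _ _].
  by rewrite -(cards1 x); apply/subset_leq_card/subsetP => _ /imsetP[y _ ->]; rewrite inE.
have [->|yz] := eqVneq y z; [by left | right].
apply/idPn => nyz; move: a1; rewrite stability_number_alpha_in leqNgt => /negP; apply.
apply: (@leq_trans #|[set y; z]|); first by rewrite cards2 yz.
apply: alpha_in_ge (subsetT _); apply/stableP => u v.
move=> /set2P[] -> /set2P[] ->; rewrite ?adj_irr //; last rewrite adj_sym; exact: negPf.
Qed.

Lemma gap_bound : 1 < #|T| ->
  3 * gap G + 2 <= #|T| \/
  exists N m c k : nat,
    [/\ ramsey_graph N m, 1 < m, 0 < c, 2 * gap G + 2 * m <= N + c + 2 * k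
      & N + 2 * c + 3 * k <= #|T| + 2].
Proof.
move=> T1; have [k [H [j [sHA tf cH cov par]]]] := triangle_packing [set: T].
have th := clique_cover_number_le cov; rewrite cardsT in cH.
have al : alpha_in G H <= stability_number G.
  by rewrite stability_number_alpha_in; apply: alpha_in_sub.
have [g0|g0] := posnP (gap G); first by left; lia.
have a2 : 1 < stability_number G.
  by rewrite ltnNge; apply/negP => /gap_small_stability g; rewrite g in g0.
have {}th : gap G + stability_number G <= k + j.
  by move: g0; rewrite /gap => g0; lia.
case: (gallai_decomposition tf) => [le|[N [m [c [PN m1 N1 c0 [le1 le2]]]]]].
  (* The gap is at most [k]; if [H] has fewer than two vertices, [1 < stability_number G] lowers
     this further. *)
  left; have [h2|h1] := leqP 2 #|H|; first by lia.
  have [S [_ sSH cS]] := alpha_in_attained G H; have := subset_leq_card sSH; lia.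
by right; exists N, m, c, k; split=> //; lia.
Qed.

End CliqueCover.

(** * Bounds on the gap of graphs with [n] vertices *)

Lemma uphalf_bounds n : n <= 2 * uphalf n <= n.+1.
Proof.
by rewrite uphalf_half; have := odd_double_half n; rewrite -mul2n; case: (odd n); lia.
Qed.

(** Each of the [i] additional units of stability number is worth six vertices; [i = 0] serves the
    exact formula and [i = 3] the general bound. *)
Lemma ramsey_graph_gap (n i : nat) (G : graph 'I_n) : 1 < n ->
  exists t, gap G + t = uphalf n /\ ramsey_graph (n + 6 * i - 15) (t + i).
Proof.
move=> n1; have nE := uphalf_bounds n.
have := @gap_bound _ G; rewrite card_ord => /(_ n1)[le|[N [m [c [k [PN m1 c0 le1 le2]]]]]].
  exists (uphalf n - gap G); split; first by lia.
  (* Here [6 * (uphalf n - gap G)] is at least [3 * n - 6 * gap G], hence at least [n + 4]. *)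
  by apply: ramsey_graph_mono (ramsey_graph_linear (uphalf n - gap G + i)); lia.
exists (uphalf n - gap G); split; first by lia.
have -> : uphalf n - gap G + i = m + (uphalf n - gap G - m + i).
  by move: nE le1 le2 c0; move: (uphalf n) (gap G) => u g; clear; lia.
(* The two inequalities leave at least [n + c + 6 * i - 16] vertices, and [c >= 1] yields the
   constant 15. *)
apply: ramsey_graph_mono (ramsey_graph_grow _ m1 PN) => //.
by move: nE le1 le2 c0; move: (uphalf n) (gap G) => u g; clear; lia.
Qed.

Lemma triangle_free_clique_cover (T : finType) (G : graph T) :
  triangle_free G -> #|T| <= 2 * clique_cover_number G.
Proof.
move=> tf; have [[P /andP[pP /forall_inP cP] <-] _] := clique_cover_numberP G.
rewrite -cardsT (card_partition pP) mulnC -sum_nat_const; apply: leq_sum => S SP.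
have /forall_inP cS := cP S SP; rewrite leqNgt; apply/negP => /card_gt2P.
case=> x [y [z [[xS yS zS] [xy yz zx]]]].
have a u v : u \in S -> v \in S -> u != v -> adj G u v.
  by move=> uS vS uv; have /forall_inP/(_ v vS)/implyP := cS u uS; apply.
apply: (triangle_freeP _ tf) (a x y xS yS xy) (a y z yS zS yz) _.
by apply: a => //; rewrite eq_sym.
Qed.

Lemma max_gap2_le n : max_gap2 n <= max_gap n.
Proof.
apply/bigmax_leqP => G _.
exact: (@leq_bigmax _ (fun G : graph 'I_n => gap G)).
Qed.

(** A triangle-free graph attaining [min_alpha n] needs at least [n / 2] cliques, as each has at
    most two vertices. *)
Lemma max_gap2_ge n : uphalf n <= max_gap2 n + min_alpha n.
Proof.
have [[G tG <-] _] := min_alphaP n.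
have := triangle_free_clique_cover tG; rewrite card_ord => le.
have : gap G <= max_gap2 n.
  exact: (@leq_bigmax_cond _ (fun G : graph 'I_n => triangle_free G) (fun G => gap G)).
have nE := uphalf_bounds n.
by rewrite /gap; have := stability_le_clique_cover G; lia.
Qed.

Lemma min_alpha_le n : min_alpha n <= n.
Proof. exact: min_alpha_ramsey_graph (ramsey_graph_edgeless n). Qed.

Lemma max_gap_attained n : exists G : graph 'I_n, max_gap n = gap G.
Proof.
pose G0 := Graph (edgeless_subproof 'I_n).
have c0 : 0 < #|{: graph 'I_n}| by apply/card_gt0P; exists G0.
by have [G eG] := eq_bigmax (fun G : graph 'I_n => gap G) c0; exists G.
Qed.

Lemma max_gap_le_add3 n : max_gap n + min_alpha n <= uphalf n + 3.
Proof.
have [G ->] := max_gap_attained n; have := min_alpha_le n.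
have [n1|n1] := leqP n 1.
  have : gap G <= n.
    rewrite (leq_trans (leq_subr _ _)) //.
    have [_ /(_ _ (clique_partition_singletons G)) le] := clique_cover_numberP G.
    by rewrite (leq_trans le) // (leq_trans (leq_imset_card _ _)) // cardsT card_ord.
  by have := uphalf_bounds n; lia.
(* Three is the least [i] with [6 * i >= 15]. *)
have [t [gt P]] := ramsey_graph_gap 3 G n1.
have : ramsey_graph n (t + 3) by apply: ramsey_graph_mono P; lia.
by move/min_alpha_ramsey_graph; lia.
Qed.

Lemma ramsey3_min_alpha n : ramsey3 (min_alpha n) <= n.
Proof.
rewrite /ramsey3; case: ex_minnP => r _; apply; apply/forallP => G.
case: (boolP (has_triangle G)) => //= tG.
have [_ /(_ G tG)] := min_alphaP n; rewrite stability_number_alpha_in => le.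
have [S [sS _ cS]] := alpha_in_attained G [set: _].
have [S'] : exists S', S' \in [set S' : {set _} | S' \subset S & #|S'| == min_alpha n].
  by apply/card_gt0P; rewrite cards_draws bin_gt0 cS.
rewrite inE => /andP[sS' cS']; apply/existsP; exists S'.
by rewrite cS' andbT (stable_sub sS').
Qed.

Lemma ramsey_graph_ramsey3 n a t : ramsey3 a <= n -> ramsey_graph n t -> a <= t.
Proof.
move=> le P; have {P} : ramsey_graph (ramsey3 a) t by apply: ramsey_graph_mono P.
rewrite /ramsey3; case: ex_minnP => r /forallP rP _ /ramsey_graph_ord[G [tG bG]].
have /orP[|/existsP[S /andP[sS /eqP <-]]] := rP G; last exact: bG.
by rewrite (negPf tG).
Qed.

Theorem theorem4p12 :
  (forall n : nat,
     (forall a : nat, ~ (ramsey3 a <= n <= ramsey3 a + 14)%N) ->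
     max_gap n = max_gap2 n /\
     ((max_gap2 n)%:Z = (uphalf n)%:Z - (min_alpha n)%:Z)%R) /\
  (forall n : nat,
     ((uphalf n)%:Z - (min_alpha n)%:Z <= (max_gap n)%:Z)%R /\
     ((max_gap n)%:Z <= (uphalf n)%:Z - (min_alpha n)%:Z + 3%:Z)%R).
Proof.
split=> n; last first.
  by have := max_gap2_ge n; have := max_gap2_le n; have := max_gap_le_add3 n; lia.
(* For [a = min_alpha n] the lower end of the interval is at most [n], so the hypothesis forces
   [ramsey3 a <= n - 15]. *)
move=> /(_ (min_alpha n)); rewrite ramsey3_min_alpha /= => /negP; rewrite -ltnNge => lt.
have [G eG] := max_gap_attained n.
have [t [gt P]] := @ramsey_graph_gap n 0 G (ltac:(lia)).
have := @ramsey_graph_ramsey3 (n - 15) (min_alpha n) t.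
rewrite muln0 !addn0 in P => /(_ _ P) le.
have {}le : min_alpha n <= t by apply: le; lia.
by have := max_gap2_ge n; have := max_gap2_le n; lia.
Qed.
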